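(* Let $K$ be a field of characteristic $0$ and let $n,m\ge 1$ be integers. Let $f_1\in K[x_1,\dots,x_n]$ be a polynomial in which $x_1$ actually occurs, let $f_2=f_2(x_2,\dots,x_n)\in K[x_2,\dots,x_n]$ be a polynomial that is not a constant, and let $$p_1=p_1(x_1,\dots,x_n)=x_1-f_1(x_1\cdot f_2,\,x_2,\dots,x_n).$$ Let $p_i=p_i(x_2,\dots,x_n)\in K[x_2,\dots,x_n]$ for $2\le i\le m$. Suppose that, for some pure lexicographic order, every polynomial in the Gröbner basis (with respect to this order) of the ideal $\langle p_1,\dots,p_m\rangle$ of $K[x_1,\dots,x_n]$ has highest monomial of the form $x_1^{k_1}\cdots x_n^{k_n}$ with all $k_i>0$, and suppose that every such highest monomial is higher (in this order) than any monomial in $x_1\cdot f_2$. Then the isomorphism $$\varphi:\ K[x_1,\dots,x_n]/\langle x_1-f_1(x_1,\dots,x_n)\cdot f_2,\,p_2,\dots,p_m\rangle\ \longrightarrow\ K[x_1,\dots,x_n]/\langle p_1,p_2,\dots,p_m\rangle$$ given by $x_1\mapsto x_1\cdot f_2$, $x_i\mapsto x_i$ for $i\ge 2$, cannot be lifted to an automorphism of $K[x_1,\dots,x_n]$.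
   Context: $\langle q_1,\dots,q_r\rangle$ denotes the ideal of $K[x_1,\dots,x_n]$ generated by $q_1,\dots,q_r$. $f_1(x_1\cdot f_2,x_2,\dots,x_n)$ is the result of substituting $x_1\cdot f_2(x_2,\dots,x_n)$ for $x_1$ in $f_1$. A pure lexicographic order on the set of monomials in $x_1,\dots,x_n$ is the one induced by an order $x_{i_1}<\dots<x_{i_n}$ on the set of variables (so that, for example, $x_{i_1}^k<x_{i_n}$ for any $k$). The Gröbner basis is the reduced Gröbner basis. An isomorphism $\varphi: K[x_1,\dots,x_n]/I\to K[x_1,\dots,x_n]/J$ of $K$-algebras can be lifted to an automorphism of $K[x_1,\dots,x_n]$ if there is a $K$-algebra automorphism $\Phi$ of $K[x_1,\dots,x_n]$ inducing $\varphi$, i.e. $\Phi(g)+J=\varphi(g+I)$ for all $g\in K[x_1,\dots,x_n]$. *)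

(* Defs.v *)
From HB Require Import structures.
From mathcomp Require Import all_boot all_order all_algebra perm.
From mathcomp Require Import boolp.
From mathcomp.multinomials Require Export mpoly.

Set Implicit Arguments.
Unset Strict Implicit.
Unset Printing Implicit Defensive.

Import GRing.Theory.
Local Open Scope ring_scope.
Local Open Scope quotient_scope.

Section Ideal.
Variable R : comPzRingType.
Implicit Type S : R -> Prop.

(* The ideal generated by the elements satisfying S. *)
Definition in_ideal S (q : R) : Prop :=
  exists s : seq (R * R),
    (forall c, c \in s -> S c.2) /\ q = \sum_(c <- s) c.1 * c.2.

(* Membership is made boolean classically, as MathComp's quotients require. *)
Definition ideal S : {pred R} := fun q => `[< in_ideal S q >].

Lemma idealP S q : reflect (in_ideal S q) (q \in ideal S).
Proof. exact: asboolP. Qed.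

Lemma idealM S a q : q \in ideal S -> a * q \in ideal S.
Proof.
move=> /idealP[s [Ss ->]]; apply/idealP.
exists [seq (a * c.1, c.2) | c <- s]; split.
  by move=> _ /mapP[c cs ->] /=; exact: (Ss c cs).
by rewrite big_map mulr_sumr; apply: eq_bigr => c _; rewrite mulrA.
Qed.

Lemma ideal_zmod_closed S : zmod_closed (ideal S).
Proof.
split=> [|q r qS rS].
  by apply/idealP; exists [::]; rewrite big_nil.
have {rS}/idealP[t [St Er]] : -1 * r \in ideal S by apply: idealM.
move: qS => /idealP[s [Ss ->]]; apply/idealP; exists (s ++ t); split.
  by move=> c; rewrite mem_cat => /orP[/Ss|/St].
by rewrite big_cat /= -Er mulN1r.
Qed.

HB.instance Definition _ S :=
  GRing.isZmodClosed.Build R (ideal S) (ideal_zmod_closed S).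

(* {ideal_quot _} in MathComp has a ring structure only when the ideal is
   proper; here the quotient is a ring, possibly zero, for every ideal. *)
Definition quot_ring S : Type := Quotient.quot (ideal S).

HB.instance Definition _ S := EqQuotient.on (quot_ring S).
HB.instance Definition _ S := GRing.Zmodule.on (quot_ring S).

Definition quot_pi S (q : R) : quot_ring S := \pi_(quot_ring S) q.

Section Ring.
Variable S : R -> Prop.
Local Notation Q := (quot_ring S).
Local Notation pr := (quot_pi S).

Lemma quot_piP q r : pr q = pr r <-> q - r \in ideal S.
Proof.
rewrite (Quotient.idealrBE (ideal S)).
by split=> [qr|/eqP qr]; [apply/eqP; exact: qr | exact: qr].
Qed.

Lemma quot_piK (u : Q) : pr (repr u) = u.
Proof. exact: reprK. Qed.

Lemma quot_piB : {morph pr : q r / q - r}.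
Proof. by move=> q r; rewrite /quot_pi raddfB. Qed.

Lemma quot_piD : {morph pr : q r / q + r}.
Proof. by move=> q r; rewrite /quot_pi raddfD. Qed.

Definition quot_one : Q := pr 1.
Definition quot_mul (u v : Q) : Q := pr (repr u * repr v).

Lemma quot_piM q r : pr (q * r) = quot_mul (pr q) (pr r).
Proof.
apply/quot_piP.
have hq : q - repr (pr q) \in ideal S by apply/quot_piP; rewrite quot_piK.
have hr : r - repr (pr r) \in ideal S by apply/quot_piP; rewrite quot_piK.
suff -> : q * r - repr (pr q) * repr (pr r) =
    r * (q - repr (pr q)) + repr (pr q) * (r - repr (pr r)).
  by apply: rpredD; apply: idealM.
by rewrite !mulrBr [repr _ * r]mulrC addrA subrK mulrC.
Qed.

Fact quot_mulA : associative quot_mul.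
Proof.
move=> u v w; rewrite -[u]quot_piK -[v]quot_piK -[w]quot_piK.
by rewrite -!quot_piM mulrA.
Qed.

Fact quot_mulC : commutative quot_mul.
Proof. by move=> u v; rewrite /quot_mul mulrC. Qed.

Fact quot_mul1 : left_id quot_one quot_mul.
Proof. by move=> u; rewrite -[u]quot_piK -quot_piM mul1r. Qed.

Fact quot_mulDl : left_distributive quot_mul +%R.
Proof.
move=> u v w; rewrite -[u]quot_piK -[v]quot_piK -[w]quot_piK.
by rewrite -quot_piD -!quot_piM mulrDl quot_piD.
Qed.

End Ring.

HB.instance Definition _ S := GRing.Zmodule_isComPzRing.Build (quot_ring S)
  (@quot_mulA S) (@quot_mulC S) (@quot_mul1 S) (@quot_mulDl S).

Fact quot_pi_monoid_morphism S : monoid_morphism (quot_pi S).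
Proof. by split=> // q r; rewrite quot_piM. Qed.

HB.instance Definition _ S :=
  GRing.isZmodMorphism.Build R (quot_ring S) (quot_pi S) (@quot_piB S).
HB.instance Definition _ S :=
  GRing.isMonoidMorphism.Build R (quot_ring S) (quot_pi S)
    (quot_pi_monoid_morphism S).

End Ideal.

Section QuotAlgebra.
Variables (K : comNzRingType) (A : comAlgType K) (S : A -> Prop).
Local Notation Q := (quot_ring S).
Local Notation pr := (quot_pi S).

Definition quot_scale (a : K) (u : Q) : Q := pr (a *: repr u).

Lemma quot_piZ a q : pr (a *: q) = quot_scale a (pr q).
Proof.
rewrite /quot_scale -mulr_algl -[a *: repr _]mulr_algl !rmorphM /=.
by rewrite quot_piK.
Qed.

Fact quot_scaleA a b u : quot_scale a (quot_scale b u) = quot_scale (a * b) u.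
Proof. by rewrite -[u]quot_piK -!quot_piZ scalerA. Qed.

Fact quot_scale1 : left_id 1 quot_scale.
Proof. by move=> u; rewrite -[u]quot_piK -quot_piZ scale1r. Qed.

Fact quot_scaleDr : right_distributive quot_scale +%R.
Proof.
move=> a u v; rewrite -[u]quot_piK -[v]quot_piK.
by rewrite -quot_piD -!quot_piZ scalerDr quot_piD.
Qed.

Fact quot_scaleDl u : {morph quot_scale^~ u : a b / a + b}.
Proof.
by move=> a b; rewrite -[u]quot_piK -!quot_piZ scalerDl quot_piD.
Qed.

HB.instance Definition _ := GRing.Zmodule_isLmodule.Build K Q
  quot_scaleA quot_scale1 quot_scaleDr quot_scaleDl.

HB.instance Definition _ := GRing.isScalable.Build K A Q _ pr quot_piZ.

(* MathComp's algebra structures exclude the zero ring, so this axiom is kept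
   as a lemma and algebra morphisms between quotients are scalable
   rmorphisms. *)
Lemma quot_scalerAl (a : K) (u v : Q) : a *: (u * v) = a *: u * v.
Proof.
rewrite -[u]quot_piK -[v]quot_piK -rmorphM /=.
by rewrite -!linearZ -rmorphM /= scalerAl.
Qed.

End QuotAlgebra.

Section Polynomials.
Variables (K : fieldType) (n : nat).
Local Notation P := {mpoly K[n]}.
Implicit Types (o : 'S_n) (a b : 'X_{1..n}) (p q : P) (S T : P -> Prop).

Definition occurs (i : 'I_n) p : bool := has (fun a => 0 < a i)%N (msupp p).

(* The permutation o encodes the ordering x_(o 0) < ... < x_(o (n - 1)) of the
   variables. *)
Definition lex_lt o a b : bool :=
  [exists k : 'I_n, (a (o k) < b (o k))%N &&
    [forall j : 'I_n, (k < j)%N ==> (a (o j) == b (o j))]].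

Definition highest o p a : bool :=
  (a \in msupp p) && all (fun b => (b == a) || lex_lt o b a) (msupp p).

(* The monomial ideal spanned by the highest monomials of the polynomials
   satisfying S; the zero polynomial contributes nothing. *)
Definition highest_ideal o S : {pred P} :=
  ideal (fun q => exists2 p, S p & exists2 a, highest o p a & q = 'X_[a]).

(* Here and below the ideal in question is the one generated by S. *)
Definition groebner_basis o S (G : seq P) : Prop :=
  (forall g, g \in G -> g \in ideal S) /\
  highest_ideal o (fun g => g \in G) =i highest_ideal o (fun g => g \in ideal S).

Definition reduced_groebner_basis o S (G : seq P) : Prop :=
  [/\ groebner_basis o S G,
      forall g, g \in G -> exists2 a, highest o g a & g@_a = 1
    & forall g a, g \in G -> a \in msupp g ->
        'X_[a] \notin highest_ideal o (fun h => h \in G /\ h <> g)].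

Definition liftable S T (phi : quot_ring S -> quot_ring T) : Prop :=
  exists Phi : {lrmorphism P -> P},
    bijective Phi /\ forall g, quot_pi T (Phi g) = phi (quot_pi S g).

Definition subst_var (i : 'I_n) q p : P :=
  p \mPo [tuple if j == i then q else 'X_j | j < n].

Definition gens m (f : 'I_m -> P) : P -> Prop := fun q => exists i, q = f i.

Definition set_first m (q : P) (f : 'I_m.+1 -> P) : 'I_m.+1 -> P :=
  fun i => if i == ord0 then q else f i.

End Polynomials.

(* Main.v *)
Require Import Defs.
From HB Require Import structures.
From mathcomp Require Import all_boot all_order all_algebra perm.

Set Implicit Arguments.
Unset Strict Implicit.
Unset Printing Implicit Defensive.

Import GRing.Theory.
Local Open Scope ring_scope.

(** Write I and J for the source and target ideals.

    The isomorphism. Let s be the substitution x_1 := x_1 f_2 and t the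
    substitution x_1 := f_1, both fixing the other variables. Then s carries
    x_1 - f_1 f_2 to p_1 f_2, which lies in J, and t carries p_1 into I, because
    t s sends x_1 to f_1 f_2, which is x_1 modulo I. Hence s and t descend to
    mutually inverse maps of the quotients (quot_lift, quot_lift_bij).

    Why it does not lift. Suppose that an automorphism Phi induces it. Then
    Phi(x_1) = x_1 f_2 + g_1 and Phi(x_i) = x_i + g_i for i > 1, with every g_i
    in J. The highest monomial of a nonzero element of J is divisible by the
    highest monomial of some element of the Groebner basis
    (groebner_divides); hence it contains all the variables and exceeds every
    monomial of x_1 f_2. It also exceeds the monomial x_i, which it strictly
    contains, there being at least two variables since f_2 is not constant.
    So if g_i were nonzero, the coordinate Phi(x_i) would have a highest
    monomial containing all the variables.

    That is impossible (coordinate_highest). For j distinct from i, the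
    derivation D = Phi d_j Phi^-1 is nonzero, locally nilpotent, and kills
    Phi(x_i); and a locally nilpotent derivation of K[x_1, .., x_n] that kills
    a polynomial whose highest monomial x^a contains all the variables must
    vanish (nilpotent_derivation_eq0). The reason is that D has a leading part
    for the lexicographic order, of the form x^delta sum_l c_l x_l d_l
    with constants c_l not all zero and delta an integer vector. It multiplies
    x^b by <c, b> x^delta, so the coefficient at the top of D^k(x^b) is the
    product of the numbers <c, b> + j <c, delta> for j < k. As D is locally
    nilpotent, one of these is zero; taking b to be a variable gives natural
    numbers k_l with c_l = - k_l s, where s = <c, delta>. Therefore s is
    nonzero. From D(p) = 0 follows <c, a> = 0, that is sum_l k_l a_l = 0 in
    characteristic 0. As all a_l are positive, all k_l and all c_l are zero, a
    contradiction.

    Hence every g_i is zero and Phi = s. But s is not onto when f_2 is not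
    constant, since f_2 does not divide x_1 in K[x_1, .., x_n]
    (not_bijective_scaled_variable). *)

(** * Lexicographic orders on monomials *)

Section LexOrder.
Variables (n : nat) (o : 'S_n).
Implicit Types a b c d : 'X_{1..n}.

Definition lex_le a b := (a == b) || lex_lt o a b.

Lemma lex_ltP a b :
  reflect (exists2 k : 'I_n, (a (o k) < b (o k))%N &
             forall j : 'I_n, (k < j)%N -> a (o j) = b (o j))
          (lex_lt o a b).
Proof.
apply: (iffP existsP) => [[k /andP[ab /forallP eq_ab]]|[k ab eq_ab]]; exists k.
- by [].
- by move=> j kj; apply/eqP; have := eq_ab j; rewrite kj.
- by rewrite ab; apply/forallP => j; apply/implyP => /eq_ab/eqP.
Qed.

Arguments lex_ltP {a b}.

Lemma lex_lt_irr a : lex_lt o a a = false.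
Proof. by apply: negbTE; apply/negP => /lex_ltP[k]; rewrite ltnn. Qed.

Lemma lex_lt_trans : transitive (lex_lt o).
Proof.
move=> b a c /lex_ltP[k ab eq_ab] /lex_ltP[l bc eq_bc]; apply/lex_ltP.
case: (ltngtP k l) => [kl|lk|/val_inj kl].
- exists l => [|j lj]; first by rewrite eq_ab.
  by rewrite eq_ab ?eq_bc // (ltn_trans kl).
- exists k => [|j kj]; first by rewrite -eq_bc.
  by rewrite eq_ab ?eq_bc // (ltn_trans lk).
- subst l; exists k => [|j kj]; first exact: ltn_trans ab bc.
  by rewrite eq_ab ?eq_bc.
Qed.

Lemma lex_lt_total a b : a != b -> lex_lt o a b || lex_lt o b a.
Proof.
move=> ab.
have [k0 Pk0] : exists k, a (o k) != b (o k).
  apply/existsP; apply: contraNT ab => /existsPn ab.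
  apply/eqP/mnmP => i; have := ab (o^-1 i)%g.
  by rewrite permKV negbK => /eqP.
case: (@arg_maxnP _ k0 (fun k => a (o k) != b (o k)) val Pk0) => k abk maxk.
have eq_ab (j : 'I_n) : (k < j)%N -> a (o j) = b (o j).
  move=> kj; apply/eqP; apply: contraTT kj => /maxk jk.
  by rewrite -leqNgt.
move: abk; rewrite neq_ltn => /orP[abk|abk]; apply/orP; [left|right];
  by apply/lex_ltP; exists k => // j /eq_ab ->.
Qed.

Lemma lex_lt_add2r c a b : lex_lt o (a + c)%MM (b + c)%MM = lex_lt o a b.
Proof.
apply/lex_ltP/lex_ltP => -[k ab eq_ab]; exists k => [|j /eq_ab].
- by move: ab; rewrite !mnmDE ltn_add2r.
- by rewrite !mnmDE => /addIn.
- by rewrite !mnmDE ltn_add2r.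
- by rewrite !mnmDE => ->.
Qed.

Lemma lex_le_trans : transitive lex_le.
Proof.
move=> b a c /orP[/eqP->//|ab] /orP[/eqP<-|bc]; apply/orP; right=> //.
exact: lex_lt_trans ab bc.
Qed.

Lemma lex_lt_le_trans a b c : lex_lt o a b -> lex_le b c -> lex_lt o a c.
Proof. by move=> ab /orP[/eqP<-//|]; apply: lex_lt_trans. Qed.

Lemma lex_leNgt a b : ~~ lex_lt o a b -> lex_le b a.
Proof.
rewrite /lex_le eq_sym; case: eqVneq => //= ab.
by have /orP[->|] := lex_lt_total ab.
Qed.

Lemma lex_le_add a b c d : lex_le a b -> lex_le c d ->
  lex_le (a + c)%MM (b + d)%MM.
Proof.
move=> ab cd; apply: (@lex_le_trans (b + c)%MM).
  by case/orP: ab => [/eqP->|ab]; rewrite /lex_le ?eqxx // lex_lt_add2r ab orbT.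
rewrite ![(b + _)%MM]addmC.
by case/orP: cd => [/eqP->|cd]; rewrite /lex_le ?eqxx // lex_lt_add2r cd orbT.
Qed.

Lemma lex_le_add_eq a b c d : lex_le a b -> lex_le c d ->
  (a + c = b + d)%MM -> a = b /\ c = d.
Proof.
move=> ab cd e.
have ea : a = b.
  case/orP: ab => [/eqP//|ab].
  have: lex_lt o (a + c)%MM (b + d)%MM.
    apply: (@lex_lt_le_trans _ (b + c)%MM); first by rewrite lex_lt_add2r.
    by apply: lex_le_add; rewrite // /lex_le eqxx.
  by rewrite e lex_lt_irr.
by split=> //; move: e; rewrite ea => /(congr1 (fun t => t - b)%MM);
  rewrite ![(b + _)%MM]addmC !addmK.
Qed.

Lemma mnm_lex_le a b : (a <= b)%MM -> lex_le a b.
Proof.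
move=> /mnm_lepP ab; apply: lex_leNgt; apply/negP => /lex_ltP[k].
by rewrite ltnNge ab.
Qed.

Lemma lex_max (s : seq 'X_{1..n}) a : a \in s ->
  exists2 b, b \in s & forall c, c \in s -> lex_le c b.
Proof.
elim: s a => // x s IHs a _; case: s IHs => [_|y s IHs].
  by exists x => [|c]; rewrite inE // => /eqP->; rewrite /lex_le eqxx.
have [b bs maxb] := IHs y (mem_head _ _).
have [xb|xb] := boolP (lex_lt o x b).
  exists b => [|c]; first by rewrite inE bs orbT.
  by rewrite inE => /orP[/eqP->|/maxb//]; rewrite /lex_le xb orbT.
exists x => [|c]; first exact: mem_head.
rewrite inE => /orP[/eqP->|/maxb cb]; first by rewrite /lex_le eqxx.
exact: lex_le_trans cb (lex_leNgt xb).
Qed.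

End LexOrder.

Section LexBound.
Variables (K : fieldType) (n : nat) (o : 'S_n).
Local Notation P := {mpoly K[n]}.
Implicit Types (p q : P) (a b c : 'X_{1..n}).

(** The monomial b need not occur in p: unlike the property of being highest,
    this one is stable under sums. *)
Definition lex_bounded p b := forall t, t \in msupp p -> lex_le o t b.

Lemma highestP p a : highest o p a <-> a \in msupp p /\ lex_bounded p a.
Proof.
rewrite /highest; split=> [/andP[-> /allP]|[-> le_a]] //.
by rewrite /=; apply/allP.
Qed.

Lemma highest_exists p : p != 0 -> exists a, highest o p a.
Proof.
move=> p0; have [a ap] : exists a, a \in msupp p.
  by exists (mlead p); apply: mlead_supp.
by have [b bp maxb] := lex_max o ap; exists b; apply/highestP.
Qed.

Lemma lex_boundedM p q b c :
  lex_bounded p b -> lex_bounded q c -> lex_bounded (p * q) (b + c)%MM.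
Proof.
move=> pb qc t /msuppM_le /allpairsP[[u v] /= [/pb ub /qc vc ->]].
exact: lex_le_add.
Qed.

Lemma lex_bounded_sum (I : Type) (r : seq I) (Q : pred I) (F : I -> P) b :
  (forall i, Q i -> lex_bounded (F i) b) ->
  lex_bounded (\sum_(i <- r | Q i) F i) b.
Proof.
move=> Fb; elim/big_ind: _ => [t|p q pb qb t|//].
  by rewrite msupp0.
by move/msuppD_le; rewrite mem_cat => /orP[/pb|/qb].
Qed.

(** The bounds b and c are only attained together, so the coefficient at
    b + c receives a single product. *)
Lemma mcoeffM_lex p q b c : lex_bounded p b -> lex_bounded q c ->
  (p * q)@_(b + c)%MM = p@_b * q@_c.
Proof.
move=> pb qc.
rewrite [p in LHS]mpolyE [p in RHS]mpolyE mulr_suml !raddf_sum /= mulr_suml.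
apply: eq_big_seq => t tp.
rewrite -scalerAl !mcoeffZ -mulrA mcoeffX; congr (_ * _).
have [->|tb] := eqVneq t b.
  by rewrite mul1r mulrC mcoeffMX.
rewrite mul0r; apply/eqP; rewrite mcoeff_eq0 mulrC.
apply: contra tb; rewrite (perm_mem (msuppMX _ _)) => /mapP[u uq e].
by have [->] := lex_le_add_eq (pb t tp) (qc u uq) (esym e).
Qed.
End LexBound.

(** * Derivations *)

Section Derivations.
Variables (K : fieldType) (n : nat).
Local Notation P := {mpoly K[n]}.
Implicit Types (p q : P) (a b : 'X_{1..n}) (D : P -> P).

Lemma mpoly_alg_ind (Q : P -> Prop) :
  Q 1 -> (forall i, Q 'X_i) ->
  (forall p q, Q p -> Q q -> Q (p + q)) ->
  (forall p q, Q p -> Q q -> Q (p * q)) ->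
  (forall c p, Q p -> Q (c *: p)) -> forall p, Q p.
Proof.
move=> Q1 QX QD QM QZ p.
have Q0 : Q 0 by rewrite -(scale0r (1 : P)); apply: QZ.
rewrite [p]mpolyE; elim/big_ind: _ => // a _; apply: QZ.
rewrite mpolyXE_id; elim/big_ind: _ => // i _.
by elim: (a i) => [|k IHk]; rewrite ?expr0 // exprS; apply: QM.
Qed.

Definition derivation D :=
  [/\ {morph D : p q / p + q}, forall c, {morph D : p / c *: p}
    & forall p q, D (p * q) = D p * q + p * D q].

Definition locally_nilpotent D := forall p, exists k, iter k D p = 0.

Lemma derivation1 D : derivation D -> D 1 = 0.
Proof.
case=> _ _ DM; have := DM 1 1; rewrite !mulr1 mul1r => D1.
by apply: (addrI (D 1)); rewrite addr0 -D1.
Qed.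

(** Both sides are derivations, and they agree on the variables. *)
Lemma derivation_chain D p : derivation D ->
  D p = \sum_(i < n) D 'X_i * p^`M(i).
Proof.
move=> derD; have [DD DZ DM] := derD.
elim/mpoly_alg_ind: p => [|j|p q IHp IHq|p q IHp IHq|c p IHp].
- rewrite derivation1 // big1 // => i _.
  by rewrite -mpolyC1 mderivC mulr0.
- rewrite (bigD1 j) //= big1 ?addr0 => [|i ij].
    rewrite mderivX mnm1E eqxx scale1r -[X in (X - _)%MM]add0m addmK.
    by rewrite mpolyX0 mulr1.
  by rewrite mderivX mnm1E eq_sym (negbTE ij) scale0r mulr0.
- rewrite DD IHp IHq -big_split; apply: eq_bigr => i _ /=.
  by rewrite mderivD mulrDr.
- rewrite DM IHp IHq mulr_suml mulr_sumr -big_split; apply: eq_bigr => i _ /=.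
  by rewrite mderivM mulrDr mulrCA !mulrA.
- rewrite DZ IHp scaler_sumr; apply: eq_bigr => i _.
  by rewrite mderivZ scalerAr.
Qed.

(** Unlike p^`M(i), this operator is diagonal on monomials, with eigenvalues the
    exponents of x_i. *)
Definition euler i p : P := 'X_i * p^`M(i).

Lemma eulerX i a : euler i 'X_[a] = (a i)%:R *: 'X_[a].
Proof.
rewrite /euler mderivX -scalerAr -mpolyXD.
case: (posnP (a i)) => [->|ai]; first by rewrite !scale0r.
congr (_ *: 'X_[_]); rewrite addmC submK //.
by rewrite lep1mP -lt0n.
Qed.

Lemma mcoeff_euler i p a : (euler i p)@_a = (a i)%:R * p@_a.
Proof.
rewrite /euler [p in LHS]mpolyE [p in RHS]mpolyE !raddf_sum mulr_sumr /=.
rewrite mulr_sumr raddf_sum; apply: eq_bigr => t _ /=.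
rewrite mderivZ -scalerAr -/(euler _ _) eulerX !mcoeffZ mcoeffX mulrCA.
by case: eqVneq => [->//|_]; rewrite !mulr0.
Qed.

Lemma eulerM i p q : euler i (p * q) = euler i p * q + p * euler i q.
Proof. by rewrite /euler mderivM mulrDr !mulrA [p * 'X_i]mulrC. Qed.

Lemma msupp_euler i p : {subset msupp (euler i p) <= msupp p}.
Proof.
move=> a; rewrite !mcoeff_msupp mcoeff_euler.
by apply: contra => /eqP->; rewrite mulr0.
Qed.

Definition mnm_ones : 'X_{1..n} := [multinom 1%N | i < n].
Local Notation M := ('X_[mnm_ones] : P).

(** With M the product of all the variables, M D = sum_i (log_coef D i) euler_i:
    multiplying by M clears the denominators of sum_i (D x_i / x_i) euler_i. *)
Definition log_coef D i : P := 'X_[mnm_ones - U_(i)] * D 'X_i.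

Lemma log_coefE D i : 'X_i * log_coef D i = M * D 'X_i.
Proof.
rewrite mulrA -mpolyXD addmC submK //.
by apply/mnm_lepP => j; rewrite mnm1E mnmE; case: eqP.
Qed.

Lemma euler_ones i k : euler i (M ^+ k) = k%:R *: M ^+ k.
Proof.
by rewrite mpolyXn eulerX mulmnE mnmE mul1n.
Qed.

(** Multiplying the k-th iterate of D by M^k keeps every exponent natural,
    whatever the integer degree of D is; moving M^k through euler_i costs the
    eigenvalue k of M^k. *)
Lemma derivation_log D k p : derivation D ->
  M ^+ k.+1 * D p =
  \sum_(i < n) log_coef D i * (euler i (M ^+ k * p) - k%:R *: (M ^+ k * p)).
Proof.
move=> derD; rewrite (derivation_chain p derD) mulr_sumr; apply: eq_bigr => i _.
rewrite eulerM euler_ones -scalerAl addrAC subrr add0r.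
move: (log_coef D i) (log_coefE D i) => h hE.
rewrite exprSr -!mulrA [M * (_ * _)]mulrA -hE /euler.
by rewrite [RHS]mulrCA -mulrA; congr (_ * _); rewrite mulrCA.
Qed.

Section TopDegree.
Variables (o : 'S_n) (D : P -> P) (d : 'X_{1..n}).
Hypothesis derD : derivation D.
Hypothesis top_d : forall i, lex_bounded o (log_coef D i) d.

(** The eigenvalue of the leading part of M D on monomials of exponents b. The
    argument is a family of scalars, because b is shifted by possibly negative
    amounts below. *)
Definition top_pairing (b : 'I_n -> K) : K :=
  \sum_(i < n) (log_coef D i)@_d * b i.

Lemma lex_bounded_derivation k p b : lex_bounded o (M ^+ k * p) b ->
  lex_bounded o (M ^+ k.+1 * D p) (d + b)%MM.
Proof.
move=> pb; rewrite derivation_log //; apply: lex_bounded_sum => i _.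
apply: lex_boundedM => // t /msuppB_le; rewrite mem_cat.
by case/orP => [/msupp_euler|/msuppZ_le] /pb.
Qed.

(** Each euler_i is diagonal, so that only the top coefficients of log_coef D i
    and of M^k p contribute at the exponent d + b. *)
Lemma mcoeff_derivation k p b : lex_bounded o (M ^+ k * p) b ->
  (M ^+ k.+1 * D p)@_(d + b)%MM =
  top_pairing (fun i => (b i)%:R - k%:R) * (M ^+ k * p)@_b.
Proof.
move=> pb; rewrite derivation_log // raddf_sum mulr_suml.
apply: eq_bigr => i _ /=.
rewrite (mcoeffM_lex (o := o)) // => [|t /msuppB_le]; last first.
  by rewrite mem_cat; case/orP => [/msupp_euler|/msuppZ_le] /pb.
by rewrite mcoeffB mcoeffZ mcoeff_euler -mulrBl mulrA.
Qed.

Lemma lex_bounded_iter k p b : lex_bounded o p b ->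
  lex_bounded o (M ^+ k * iter k D p) (d *+ k + b)%MM.
Proof.
elim: k => [|k IHk] pb; first by rewrite expr0 mul1r mulm0n add0m.
by rewrite mulmS -addmA iterS; apply: lex_bounded_derivation; apply: IHk.
Qed.

Lemma top_pairing_shift k b :
  top_pairing (fun i => ((d *+ k + b)%MM i)%:R - k%:R) =
  top_pairing (fun i => (b i)%:R) + k%:R * top_pairing (fun i => (d i)%:R - 1).
Proof.
rewrite /top_pairing mulr_sumr -big_split; apply: eq_bigr => i _ /=.
rewrite [k%:R * _]mulrCA -mulrDr; congr (_ * _).
by rewrite mnmDE mulmnE natrD natrM mulrBr mulr1 [k%:R * _]mulrC addrAC addrC.
Qed.

(** The coefficient of M^k D^k p at d k + b is p@_b times the product over
    j < k of the left-hand sides below; as D^k p = 0, one of them vanishes. *)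
Lemma top_pairing_iter k p b : highest o p b -> iter k D p = 0 ->
  exists j, top_pairing (fun i => (b i)%:R)
              + j%:R * top_pairing (fun i => (d i)%:R - 1) = 0.
Proof.
move=> /highestP[bp pb] Dk0.
have: (M ^+ k * iter k D p)@_(d *+ k + b)%MM = 0 by rewrite Dk0 mulr0 mcoeff0.
elim: k {Dk0} => [|k IHk].
  rewrite expr0 mul1r mulm0n add0m => /eqP.
  by rewrite mcoeff_eq0 bp.
rewrite mulmS -addmA iterS mcoeff_derivation; last exact: lex_bounded_iter.
rewrite top_pairing_shift => /eqP.
rewrite mulf_eq0 => /orP[/eqP eq0|/eqP/IHk//].
by exists k.
Qed.

End TopDegree.

Hypothesis charK : [pchar K] =i pred0.

(** This is the obstruction on highest monomials. If D were nonzero, its leading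
    part would have coefficients c_l = - k_l s with natural numbers k_l, and
    D p = 0 would force sum_l k_l a_l = 0 in K. *)
Lemma nilpotent_derivation_eq0 (o : 'S_n) D p a :
  derivation D -> locally_nilpotent D ->
  highest o p a -> (forall i, (0 < a i)%N) -> D p = 0 ->
  forall i, D 'X_i = 0.
Proof.
move=> derD nilD pa a_gt0 Dp0 i; apply/eqP.
apply: contraT => Dx0.
have M0 b : ('X_[b] : P) != 0 by rewrite -msupp_eq0 msuppX.
have [d /flatten_mapP[j _ dj] max_d] : exists2 d,
    d \in flatten [seq msupp (log_coef D j) | j <- enum 'I_n] &
    forall t, t \in flatten [seq msupp (log_coef D j) | j <- enum 'I_n] ->
      lex_le o t d.
  apply: (@lex_max _ o _ (mlead (log_coef D i))); apply/flatten_mapP.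
  exists i; first by rewrite mem_enum.
  by rewrite mlead_supp // mulf_neq0.
have top_d l : lex_bounded o (log_coef D l) d.
  by move=> t tl; apply: max_d; apply/flatten_mapP; exists l; rewrite ?mem_enum.
(* c is the coefficient vector of the leading part of D, and d - (1, .., 1)
   its degree. *)
set c := fun l => (log_coef D l)@_d.
have cj : c j != 0 by rewrite /c -mcoeff_msupp.
set s := top_pairing D d (fun l => (d l)%:R - 1).
(* Local nilpotency on the variable x_l. *)
have cE l : exists k, c l + k%:R * s = 0.
  have [k Dk] := nilD 'X_l.
  have Xl : highest o ('X_l : P) U_(l).
    by apply/highestP; split=> [|t]; rewrite msuppX inE // /lex_le => ->.
  have [k' e] := top_pairing_iter derD top_d Xl Dk.
  exists k'; rewrite -{}[RHS]e; congr (_ + _).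
  rewrite /top_pairing (bigD1 l) //= mnm1E eqxx mulr1 big1 ?addr0 // => l' l'l.
  by rewrite mnm1E eq_sym (negbTE l'l) mulr0.
(* D p = 0, read at the top exponent d + a of M D p. *)
have ca : \sum_(l < n) c l * (a l)%:R = 0.
  have /highestP[ap pb] := pa.
  have := @mcoeff_derivation o D d derD top_d 0 p a.
  rewrite !expr0 expr1 !mul1r Dp0 mulr0 mcoeff0 => /(_ pb)/esym/eqP.
  rewrite mulf_eq0 mcoeff_eq0 ap orbF => /eqP e; rewrite -[RHS]e.
  by apply: eq_bigr => l _; rewrite subr0.
have [k kE] := fin_all_exists cE.
have kaE : s * (\sum_(l < n) k l * a l)%N%:R = 0.
  apply: oppr_inj; rewrite oppr0 -[RHS]ca natr_sum mulr_sumr -sumrN.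
  apply: eq_bigr => l _.
  by rewrite natrM mulrA [s * _]mulrC -(addr0_eq (kE l)) mulNr opprK.
have s0 : s != 0.
  by apply: contra cj => /eqP s0; rewrite -(kE j) s0 mulr0 addr0.
have : c j = 0.
  move/eqP: kaE; rewrite mulf_eq0 (negbTE s0) ((pcharf0P K).1 charK).
  rewrite sum_nat_eq0.
  move=> /forallP/(_ j); rewrite muln_eq0 => /orP[/eqP kj|].
    by have := kE j; rewrite kj mul0r addr0.
  by rewrite eqn0Ngt a_gt0.
by move/eqP; rewrite (negbTE cj).
Qed.

End Derivations.

(** * Highest monomials of coordinates *)

Section Coordinates.
Variables (K : fieldType) (n : nat).
Local Notation P := {mpoly K[n]}.

Lemma mderiv_nilpotent (j : 'I_n) (p : P) : iter (msize p) (mderiv j) p = 0.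
Proof.
move: (leqnn (msize p)); move: {2 3}(msize p) => k.
elim: k p => [|k IHk] p pk.
  by apply/eqP; rewrite -msize_poly_eq0 -leqn0.
rewrite iterSr; apply: IHk.
rewrite msizeE; apply/bigmax_leqP_seq => t tp _.
rewrite -ltnS; apply: leq_trans pk.
have : (t + U_(j))%MM \in msupp p.
  move: tp; rewrite !mcoeff_msupp mcoeff_deriv.
  by apply: contra => /eqP->; rewrite mul0rn.
by move/msize_mdeg_lt; rewrite mdegD mdeg1 addn1.
Qed.

Hypothesis charK : [pchar K] =i pred0.

(** Conjugating d/dx_j by Phi gives a locally nilpotent derivation that kills
    Phi x_i and maps Phi x_j to 1. *)
Lemma coordinate_highest (o : 'S_n) (Phi : {lrmorphism P -> P}) i j a :
  bijective Phi -> j != i -> highest o (Phi 'X_i) a ->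
  ~ forall l, (0 < a l)%N.
Proof.
move=> [Psi PhiK PsiK] ji Xa a_gt0.
pose D p := Phi (mderiv j (Psi p)).
have DPhi p : D (Phi p) = Phi (mderiv j p) by rewrite /D PhiK.
have Dd : derivation D.
  split=> [p q|c p|p q].
  - by rewrite -[p]PsiK -[q]PsiK -rmorphD !DPhi linearD rmorphD.
  - by rewrite -[p]PsiK -linearZ !DPhi !linearZ.
  - by rewrite -[p]PsiK -[q]PsiK -rmorphM !DPhi mderivM rmorphD !rmorphM.
have nilD : locally_nilpotent D.
  move=> p; exists (msize (Psi p)).
  have -> k : iter k D p = Phi (iter k (mderiv j) (Psi p)).
    by elim: k => [|k IHk] /=; rewrite ?PsiK // IHk DPhi.
  by rewrite mderiv_nilpotent rmorph0.
have DX k : D (Phi 'X_k) = (k == j)%:R.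
  rewrite DPhi mderivX mnm1E.
  case: eqVneq => [->|_]; last by rewrite scale0r rmorph0.
  by rewrite scale1r -[X in (X - _)%MM]add0m addmK mpolyX0 rmorph1.
have D0 : forall l, D 'X_l = 0.
  apply: (nilpotent_derivation_eq0 charK Dd nilD Xa a_gt0).
  by rewrite DX eq_sym (negbTE ji).
have /eqP := DX j; rewrite (derivation_chain _ Dd) big1 => [|l _].
  by rewrite eqxx eq_sym oner_eq0.
by rewrite D0 mul0r.
Qed.

End Coordinates.

(** * Morphisms between quotients *)

Section QuotientMorphisms.
Variables (K : fieldType) (n : nat).
Local Notation P := {mpoly K[n]}.
Implicit Types (S T : P -> Prop).

Lemma quot_pi_eq0 S q : S q -> quot_pi S q = 0.
Proof.
move=> Sq; rewrite -(rmorph0 (quot_pi S)); apply/quot_piP; rewrite subr0.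
apply/idealP; exists [:: (1, q)]; rewrite big_seq1 mul1r; split=> // c.
by rewrite inE => /eqP->.
Qed.

(** Congruences modulo an ideal between algebra endomorphisms need only be
    checked on the variables. *)
Lemma eq_quot_pi S (s t : {lrmorphism P -> P}) q :
  (forall i, quot_pi S (s 'X_i) = quot_pi S (t 'X_i)) ->
  quot_pi S (s q) = quot_pi S (t q).
Proof.
move=> st; elim/mpoly_alg_ind: q => [|i|p q IHp IHq|p q IHp IHq|c p IHp] //.
- by rewrite !rmorph1.
- by rewrite !rmorphD /= IHp IHq.
- by rewrite !rmorphM /= IHp IHq.
- by rewrite !linearZ /= !quot_piZ IHp.
Qed.

Lemma quot_lift S T (s : {lrmorphism P -> P}) :
  (forall q, S q -> quot_pi T (s q) = 0) ->
  exists2 f : {rmorphism quot_ring S -> quot_ring T},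
    scalable f & forall q, f (quot_pi S q) = quot_pi T (s q).
Proof.
move=> s_S; pose f (u : quot_ring S) := quot_pi T (s (repr u)).
have fE q : f (quot_pi S q) = quot_pi T (s q).
  have /idealP[l [Sl e]] : repr (quot_pi S q) - q \in ideal S.
    by apply/quot_piP; rewrite quot_piK.
  apply/eqP; rewrite /f -subr_eq0 -!rmorphB e !rmorph_sum big1_seq //= => c.
  by move=> cl; rewrite !rmorphM /= (s_S c.2 (Sl c cl)) mulr0.
have fB : zmod_morphism f.
  by move=> u v; rewrite -[u]quot_piK -[v]quot_piK -rmorphB !fE !rmorphB.
have fM : monoid_morphism f.
  split=> [|u v]; first by rewrite -(rmorph1 (quot_pi S)) fE !rmorph1.
  by rewrite -[u]quot_piK -[v]quot_piK -rmorphM !fE !rmorphM.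
pose af := GRing.isZmodMorphism.Build _ _ f fB.
pose mf := GRing.isMonoidMorphism.Build _ _ f fM.
pose F : {rmorphism quot_ring S -> quot_ring T} := HB.pack f af mf.
have scaleE U c q : c *: quot_pi U q = quot_pi U (c *: q) by rewrite quot_piZ.
exists F => // c u; rewrite -[u]quot_piK scaleE.
by rewrite /= !fE scaleE linearZ.
Qed.

(** The inverse is induced by t. *)
Lemma quot_lift_bij S T (s t : {lrmorphism P -> P})
    (f : {rmorphism quot_ring S -> quot_ring T}) :
  (forall q, f (quot_pi S q) = quot_pi T (s q)) ->
  (forall q, T q -> quot_pi S (t q) = 0) ->
  (forall i, quot_pi S (t (s 'X_i)) = quot_pi S 'X_i) ->
  (forall i, quot_pi T (s (t 'X_i)) = quot_pi T 'X_i) ->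
  bijective f.
Proof.
move=> fE t_T ts st; have [g _ gE] := quot_lift t_T.
exists g => u; rewrite -[u]quot_piK (fE, gE) (gE, fE).
  exact: (eq_quot_pi (s := t \o s) (t := idfun)).
exact: (eq_quot_pi (s := s \o t) (t := idfun)).
Qed.

End QuotientMorphisms.

(** * Substitutions and Groebner bases *)

Section Substitution.
Variables (K : fieldType) (n : nat).
Local Notation P := {mpoly K[n]}.
Implicit Types (p q : P).

Lemma subst_varX i j q : subst_var i q 'X_j = if j == i then q else 'X_j.
Proof. by rewrite /subst_var comp_mpolyXU -tnth_nth tnth_mktuple. Qed.

Lemma subst_var_id i q p : ~~ occurs i p -> subst_var i q p = p.
Proof.
move=> /hasPn ip; rewrite /subst_var comp_mpolyE [RHS]mpolyE.
apply: eq_big_seq => a /ip; rewrite -leqNgt leqn0 => /eqP ai.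
rewrite mpolyXE_id; congr (_ *: _); apply: eq_bigr => j _.
by rewrite tnth_mktuple; case: eqVneq => // ->; rewrite ai !expr0.
Qed.

Lemma occurs_nonconst p : (~ exists c, p = c%:MP) -> exists j, occurs j p.
Proof.
move=> pc; apply/existsP; apply: contra_notT pc => /existsPn noX.
exists p@_0; apply: msize1_polyC; rewrite msizeE.
apply/bigmax_leqP_seq => a ap _.
suff -> : a = 0%MM by rewrite mdeg0.
apply/mnmP => i; rewrite mnm0E; apply/eqP; rewrite -leqn0 leqNgt.
by have /hasPn/(_ a ap) := noX i.
Qed.

(** An algebra endomorphism is determined by the images of the variables. *)
Lemma lrmorphism_subst (Phi : {lrmorphism P -> P}) i p :
  (forall j, j != i -> Phi 'X_j = 'X_j) -> Phi p = subst_var i (Phi 'X_i) p.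
Proof.
move=> Xj; rewrite /subst_var; set lq := mktuple _.
have PhiX j : Phi 'X_j = 'X_j \mPo lq.
  by rewrite -/(subst_var _ _ _) subst_varX; case: eqVneq => [->|/Xj].
elim/mpoly_alg_ind: p => [|//|p q IHp IHq|p q IHp IHq|c p IHp].
- by rewrite !rmorph1.
- by rewrite !rmorphD /= IHp IHq.
- by rewrite !rmorphM /= IHp IHq.
- by rewrite !linearZ /= IHp.
Qed.

End Substitution.

Section GroebnerBasis.
Variables (K : fieldType) (n : nat) (o : 'S_n).
Local Notation P := {mpoly K[n]}.
Implicit Types (g h q r : P) (S : P -> Prop) (a b : 'X_{1..n}).

(** A monomial that lies in an ideal generated by monomials is a multiple of one
    of the generators. *)
Lemma groebner_divides S (G : seq P) g a :
  groebner_basis o S G -> g \in ideal S -> highest o g a ->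
  exists h b, [/\ h \in G, highest o h b & (b <= a)%MM].
Proof.
move=> [_ eqG] gS ga.
have : 'X_[a] \in highest_ideal o (fun h => h \in ideal S).
  apply/idealP; exists [:: (1, 'X_[a])]; rewrite big_seq1 mul1r; split=> // c.
  by rewrite inE => /eqP->; exists g => //; exists a.
rewrite -eqG => /idealP[l [Gl Xa]].
have /hasP[c cl ca] : has (fun c : P * P => (c.1 * c.2)@_a != 0) l.
  apply/negPn/negP => /hasPn l0.
  have /eqP := mcoeffX K a a; rewrite Xa raddf_sum big1_seq /=.
    by rewrite eqxx eq_sym oner_eq0.
  by move=> c cl; apply/eqP/negPn/l0.
have [h hG [b hb c2]] := Gl c cl; exists h, b; split=> //.
move: ca; rewrite c2 -mcoeff_msupp (perm_mem (msuppMX _ _)) => /mapP[t _ ->].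
exact: lem_addr.
Qed.

Lemma highestD q r a : (forall b, b \in msupp r -> lex_lt o b a) ->
  highest o q a -> highest o (r + q) a.
Proof.
move=> ra /highestP[aq qa]; apply/highestP; split=> [|t].
  rewrite mcoeff_msupp mcoeffD [r@_a]memN_msupp_eq0 ?add0r -?mcoeff_msupp //.
  by apply/negP => /ra; rewrite lex_lt_irr.
move/msuppD_le; rewrite mem_cat => /orP[/ra|/qa//].
by rewrite /lex_le => ->; rewrite orbT.
Qed.

End GroebnerBasis.

(** * Impossibility of lifting *)

(** Such a bijective Phi would fix f, so q = Phi^-1 x_i would satisfy
    q f = x_i. By degrees q is then a scalar, hence f is a scalar multiple of
    x_i, in which x_i occurs. *)
Lemma not_bijective_scaled_variable (K : fieldType) (n : nat)
    (i : 'I_n) (f : {mpoly K[n]})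
    (Phi : {lrmorphism {mpoly K[n]} -> {mpoly K[n]}}) :
  ~~ occurs i f -> (~ exists c, f = c%:MP) ->
  Phi 'X_i = 'X_i * f -> (forall j, j != i -> Phi 'X_j = 'X_j) ->
  ~ bijective Phi.
Proof.
move=> fi fc Xi Xj [Psi PhiK PsiK].
have Phif : Phi f = f by rewrite (lrmorphism_subst _ Xj) subst_var_id.
have e : Psi 'X_i * f = 'X_i.
  by apply: (can_inj PhiK); rewrite rmorphM /= PsiK Phif Xi.
have f0 : f != 0 by apply/eqP => f0; apply: fc; exists 0; rewrite f0 mpolyC0.
have q0 : Psi 'X_i != 0.
  by apply: contraTneq (erefl true) => q0; have := msizeX K U_(i);
    rewrite -e q0 mul0r msize0.
have f1 : (1 < msize f)%N.
  by rewrite ltnNge; apply/negP => /msize1_polyC fE; apply: fc; exists f@_0.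
have /msize1_polyC qE : (msize (Psi 'X_i) <= 1)%N.
  have := msizeM q0 f0; rewrite e msizeX mdeg1.
  case: (msize f) f1 => [|[|k]] // _; rewrite addnS /= addnS => -[->].
  by rewrite leq_addr.
case/hasP: fi; exists U_(i)%MM; last by rewrite mnm1E eqxx.
move/(congr1 (mcoeff U_(i))): e; rewrite qE mcoeffCM mcoeffXU eqxx.
rewrite mcoeff_msupp; case: eqP => // ->; rewrite mulr0 => /eqP.
by rewrite eq_sym oner_eq0.
Qed.


Theorem theorem1p3 (K : fieldType) (charK : [pchar K] =i pred0) (n m : nat)
    (f1 f2 : {mpoly K[n.+1]})
    (f1_x1 : occurs ord0 f1)
    (f2_x1 : ~~ occurs ord0 f2)
    (f2_nonconst : ~ exists c : K, f2 = c%:MP)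
    (p : 'I_m.+1 -> {mpoly K[n.+1]})
    (p_first : p ord0 = 'X_ord0 - subst_var ord0 ('X_ord0 * f2) f1)
    (p_other : forall i, i != ord0 -> ~~ occurs ord0 (p i))
    (o : 'S_n.+1) (G : seq {mpoly K[n.+1]})
    (G_basis : reduced_groebner_basis o (gens p) G)
    (G_highest : forall g a, g \in G -> highest o g a ->
       (forall i, (0 < a i)%N) /\
       (forall b, b \in msupp ('X_ord0 * f2) -> lex_lt o b a)) :
  exists phi : {rmorphism quot_ring (gens (set_first ('X_ord0 - f1 * f2) p))
                          -> quot_ring (gens p)},
    [/\ scalable phi,
        bijective phi,
        phi (quot_pi _ 'X_ord0) = quot_pi _ ('X_ord0 * f2),
        forall i, i != ord0 -> phi (quot_pi _ 'X_i) = quot_pi _ 'X_i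
      & ~ liftable phi].
Proof.
have [j jf2] := occurs_nonconst f2_nonconst.
have j0 : j != ord0 by apply: contraNneq f2_x1 => <-.
set S := gens (set_first _ p); set J := gens p.
pose s1 := [tuple if j == ord0 then 'X_ord0 * f2 else 'X_j | j < n.+1].
pose t1 := [tuple if j == ord0 then f1 else 'X_j | j < n.+1].
pose s : {lrmorphism {mpoly K[n.+1]} -> {mpoly K[n.+1]}} := comp_mpoly s1.
pose t : {lrmorphism {mpoly K[n.+1]} -> {mpoly K[n.+1]}} := comp_mpoly t1.
have sE q : s q = subst_var ord0 ('X_ord0 * f2) q by [].
have tE q : t q = subst_var ord0 f1 q by [].
clearbody s t.
have sX0 : s 'X_ord0 = 'X_ord0 * f2 by rewrite sE subst_varX eqxx.
have tX0 : t 'X_ord0 = f1 by rewrite tE subst_varX eqxx.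
have sX i : i != ord0 -> s 'X_i = 'X_i by rewrite sE subst_varX => /negbTE->.
have tX i : i != ord0 -> t 'X_i = 'X_i by rewrite tE subst_varX => /negbTE->.
have sf2 : s f2 = f2 by rewrite sE subst_var_id.
have tf2 : t f2 = f2 by rewrite tE subst_var_id.
have S0 : quot_pi S 'X_ord0 = quot_pi S (f1 * f2).
  apply/eqP; rewrite -subr_eq0 -rmorphB; apply/eqP/quot_pi_eq0.
  by exists ord0; rewrite /set_first eqxx.
have J0 : quot_pi J 'X_ord0 = quot_pi J (s f1).
  apply/eqP; rewrite -subr_eq0 -rmorphB; apply/eqP/quot_pi_eq0.
  by exists ord0; rewrite p_first sE.
have Spi i : i != ord0 -> quot_pi S (p i) = 0.
  by move=> i0; apply: quot_pi_eq0; exists i; rewrite /set_first (negbTE i0).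
have Jpi i : quot_pi J (p i) = 0 by apply: quot_pi_eq0; exists i.
have s_S q : S q -> quot_pi J (s q) = 0.
  case=> i ->; rewrite /set_first; case: eqVneq => [_|i0].
    have -> : s ('X_ord0 - f1 * f2) = ('X_ord0 - s f1) * f2.
      by rewrite rmorphB rmorphM /= sX0 sf2 mulrBl.
    by rewrite rmorphM rmorphB /= J0 subrr mul0r.
  by rewrite sE subst_var_id ?p_other.
have tsX i : quot_pi S (t (s 'X_i)) = quot_pi S 'X_i.
  have [->|i0] := eqVneq i ord0; last by rewrite sX ?tX.
  by rewrite sX0 rmorphM /= tX0 tf2.
have stX i : quot_pi J (s (t 'X_i)) = quot_pi J 'X_i.
  have [->|i0] := eqVneq i ord0; last by rewrite tX ?sX.
  by rewrite tX0.
have t_J q : J q -> quot_pi S (t q) = 0.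
  case=> i ->; have [->|i0] := eqVneq i ord0; last first.
    by rewrite tE subst_var_id ?p_other ?Spi.
  rewrite p_first -sE !rmorphB /= tX0.
  by rewrite (eq_quot_pi (s := t \o s) (t := idfun) f1 tsX) subrr.
have [phi phiZ phiE] := quot_lift s_S.
exists phi; split=> //.
- exact: (quot_lift_bij phiE t_J tsX stX).
- by rewrite phiE sX0.
- by move=> i i0; rewrite phiE sX.
case=> Phi [bijPhi PhiE]; have [groebG _ _] := G_basis.
have PhiX i : exists2 g, g \in ideal J & Phi 'X_i = s 'X_i + g.
  exists (Phi 'X_i - s 'X_i); last by rewrite addrC subrK.
  by apply/quot_piP; rewrite PhiE phiE.
(* A nonzero correction g in J would make the highest monomial of the
   coordinate Phi 'X_i contain all the variables. *)
have PhiX_eq i : Phi 'X_i = s 'X_i.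
  have [g gJ Xi] := PhiX i; rewrite Xi.
  have [->|g0] := eqVneq g 0; first by rewrite addr0.
  have [a ga] := highest_exists o g0.
  have [h [b [hG hb ba]]] := groebner_divides groebG gJ ga.
  have [b_gt0 f2b] := G_highest h b hG hb.
  have a_gt0 l : (0 < a l)%N by apply: leq_trans (mnm_lepP ba l).
  have [k ki] : exists k, k != i.
    by have [->|i0] := eqVneq i ord0; [exists j | exists ord0; rewrite eq_sym].
  have Xa : highest o (Phi 'X_i) a.
    rewrite Xi; apply: highestD ga.
    have [->|i0] := eqVneq i ord0.
      by rewrite sX0 => c /f2b cb; apply: lex_lt_le_trans cb (mnm_lex_le o ba).
    rewrite sX // => c; rewrite msuppX inE => /eqP->.
    have /orP[/eqP e|//] : lex_le o U_(i) a.
      by apply: mnm_lex_le; rewrite lep1mP -lt0n.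
    by have := a_gt0 k; rewrite -e mnm1E eq_sym (negbTE ki).
  by case: (coordinate_highest charK bijPhi ki Xa).
apply: (not_bijective_scaled_variable f2_x1 f2_nonconst) bijPhi.
  by rewrite PhiX_eq.
by move=> i i0; rewrite PhiX_eq sX.
Qed.
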